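(* Let $Y$ be a real vector space, $F\subseteq Y$, $D$ a nonempty proper subset of $Y$ and $k\in Y\setminus\{0\}$. Assume $D+\mathbb{R}_>k\subseteq\operatorname{core}D$. Then $$\operatorname{WEff}(F,D)=\{y^0\in F\mid\forall y\in(F\cap\operatorname{dom}\varphi_{y^0-D,k})\setminus\{y^0\}:\ \varphi_{y^0-D,k}(y)\ge0\}$$ $$=\{y^0\in F\mid\forall y\in(F\cap\operatorname{dom}\varphi_{y^0-D,k})\setminus\{y^0\}:\ \varphi_{-D,k}(y-y^0)\ge0\}.$$ Assume now, additionally, that $D$ is $(-k)$-directionally closed. If $0\in D$, then $\varphi_{y^0-D,k}(y^0)=\varphi_{-D,k}(y^0-y^0)\le0$ for each $y^0\in Y$. If $0\in D\setminus\operatorname{core}D$, then $\varphi_{y^0-D,k}(y^0)=\varphi_{-D,k}(y^0-y^0)=0$ for each $y^0\in Y$ and $$\operatorname{WEff}(F,D)=\{y^0\in F\mid\varphi_{y^0-D,k}(y^0)=\min_{y\in F\cap\operatorname{dom}\varphi_{y^0-D,k}}\varphi_{y^0-D,k}(y)\}$$ $$=\{y^0\in F\mid\varphi_{-D,k}(y^0-y^0)=\min_{y\in F\cap\operatorname{dom}\varphi_{y^0-D,k}}\varphi_{-D,k}(y-y^0)\}.$$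
   Context: For $F,D\subseteq Y$, $\operatorname{Eff}(F,D):=\{y^0\in F\mid F\cap(y^0-D)\subseteq\{y^0\}\}$ and $\operatorname{WEff}(F,D):=\operatorname{Eff}(F,\operatorname{core}D)$. $\operatorname{core}D$ is the algebraic interior: $d\in\operatorname{core}D$ iff $d\in D$ and for each $v\in Y$ there is $\varepsilon>0$ with $d+sv\in D$ for all $s\in[0,\varepsilon]$. $\mathbb{R}_>=(0,\infty)$. Let $\nu$ be a symbol not in $\mathbb{R}\cup\{-\infty,+\infty\}$ and $\inf\emptyset:=\nu$. For nonempty $A\subseteq Y$ and $k\in Y\setminus\{0\}$, $\varphi_{A,k}(y):=\inf\{t\in\mathbb{R}\mid y\in A+tk\}$ ($-\infty$ if unbounded below) and $\operatorname{dom}\varphi_{A,k}=\{y\in Y\mid\varphi_{A,k}(y)\in\mathbb{R}\cup\{-\infty\}\}$. $D$ is $(-k)$-directionally closed if for every $y\in Y$: whenever there is a sequence $(t_n)$ of positive reals decreasing to $0$ with $y+t_nk\in D$ for all $n$, then $y\in D$. *)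

(* Defs.v *)
From HB Require Import structures.
From mathcomp Require Import all_boot all_order all_algebra.
From mathcomp Require Import all_classical all_reals all_analysis.

Set Implicit Arguments.
Unset Strict Implicit.
Unset Printing Implicit Defensive.
Import Order.TTheory GRing.Theory Num.Theory.
Import numFieldNormedType.Exports.

Local Open Scope classical_set_scope.
Local Open Scope ring_scope.

Section VectorOptimization.
Variables (R : realType) (Y : lmodType R).
Implicit Types (A D F S : set Y) (k y : Y).

Definition core D : set Y :=
  [set d | D d /\ forall v, exists2 e : R, 0 < e &
                  forall s : R, 0 <= s <= e -> D (d + s *: v)].

Definition Eff F D : set Y :=
  [set y0 | F y0 /\ F `&` [set y0 - d | d in D] `<=` [set y0]].

Definition WEff F D : set Y := Eff F (core D).

(* [None] is the symbol nu, which lies outside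
   the extended reals and is the infimum of the empty set; it is comparable
   with nothing. *)
Definition infnu (T : set R) : option (\bar R) :=
  if T == set0 then None else Some (ereal_inf (EFin @` T)).

Definition lenu (u v : option (\bar R)) : Prop :=
  match u, v with
  | Some a, Some b => (a <= b)%E
  | _, _ => False
  end.

Definition phi A k (y : Y) : option (\bar R) :=
  infnu [set t : R | [set a + t *: k | a in A] y].

Definition domnu (f : Y -> option (\bar R)) : set Y :=
  [set y | (exists r : R, f y = Some r%:E) \/ f y = Some -oo%E].

Definition is_min (f : Y -> option (\bar R)) S (m : option (\bar R)) : Prop :=
  (exists2 y, S y & f y = m) /\ (forall y, S y -> lenu m (f y)).

(* (-k)-directional closedness: the argument is [k], not [- k]. *)
Definition opp_dir_closed k D : Prop :=
  forall y, (exists t : R^nat,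
      [/\ forall n, 0 < t n, decreasing_seq t, t @ \oo --> (0 : R)
        & forall n, D (y + t n *: k)]) -> D y.

End VectorOptimization.

(* Main.v *)
Require Import Defs.
From HB Require Import structures.
From mathcomp Require Import all_boot all_order all_algebra.
From mathcomp Require Import all_classical all_reals all_analysis.
Import Order.TTheory GRing.Theory Num.Theory.
Import numFieldNormedType.Exports.
Local Open Scope classical_set_scope.
Local Open Scope ring_scope.

(** Everything happens on the lines parallel to [k].  A vector [y] lies in
    [y0 - D + t k] exactly when [y0 - y + t k] lies in [D], so the value of the
    functional of [y0 - D] at [y] is the infimum of the parameters [t] at which
    the line through [y0 - y] with direction [k] is inside [D]
    ([phi_reflectE]).  This depends on [y0 - y] only, which is why the
    functionals of [y0 - D] at [y] and of [- D] at [y - y0] agree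
    ([phi_translate]) and why each claim is needed for one of them only.

    The assumption on [D] turns the algebraic interior into a sign condition on
    these parameters: [z] is in [core D] iff [D] meets the line through [z] at
    a negative parameter ([core_lineP]).  Hence for [y] in the domain the
    functional is nonnegative iff [y0 - y] is outside [core D], while outside
    the domain the line misses [D] and [y0 - y] is not in [core D] either.
    Ranging over the [y] in [F] other than [y0], this is weak efficiency of
    [y0] ([WEff_phi_ge0]).

    At [y = y0] the line passes through [0].  If [0] is in [D], the parameter
    [0] is admissible and the value is at most [0]; if moreover [0] is outside
    [core D], no negative parameter is admissible and the value is [0].
    Nonnegativity at the other points then says that the value at [y0] is
    minimal ([WEff_phi_min]). *)

Section WeakEfficiency.
Set Implicit Arguments.
Unset Strict Implicit.
Unset Printing Implicit Defensive.
Variables (R : realType) (Y : lmodType R).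
Implicit Types (F D : set Y) (k y z : Y) (T : set R).

Lemma infnu_ge0 T : T !=set0 ->
  lenu (Some 0%E) (infnu T) <-> (forall t, T t -> 0 <= t).
Proof.
move=> /set0P /negbTE T0; rewrite /infnu T0 /=; split=> [le0 t Tt|ge0].
  by rewrite -lee_fin; apply: le_trans le0 _; apply: ereal_inf_lbound; exists t.
by apply: le_ereal_inf_tmp => _ [t Tt <-]; rewrite lee_fin ge0.
Qed.

Lemma infnu_le T t : T t -> lenu (infnu T) (Some t%:E).
Proof.
move=> Tt; have /set0P /negbTE T0 : T !=set0 by exists t.
by rewrite /infnu T0; apply: ereal_inf_lbound; exists t.
Qed.

Lemma lenu_anti (u v : option (\bar R)) : lenu u v -> lenu v u -> u = v.
Proof.
by case: u v => [a|] [b|] //= ab ba; congr Some; apply/le_anti/andP.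
Qed.

Lemma phi_reflectE D k y0 y :
  phi [set y0 - d | d in D] k y = infnu [set t | D (y0 - y + t *: k)].
Proof.
congr infnu; apply/seteqP; split=> t /=.
  by move=> [_ [d Dd <-] <-]; rewrite !opprD opprK addrA addrA subrr add0r subrK.
move=> Dt; exists (y - t *: k); last by rewrite subrK.
exists (y0 - y + t *: k) => //.
by rewrite !opprD opprK addrA addrA subrr add0r.
Qed.

Lemma phi_translate D k y0 y :
  phi [set - d | d in D] k (y - y0) = phi [set y0 - d | d in D] k y.
Proof.
have -> : [set - d | d in D] = [set 0 - d | d in D].
  by apply: eq_imagel => d _; rewrite sub0r.
by rewrite !phi_reflectE sub0r opprB.
Qed.

(** The value [+oo] does not occur: the infimum of a nonempty set of reals is
    below each of its elements, and that of the empty set is the extra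
    symbol. *)
Lemma domnu_phiP D k y0 y :
  domnu (phi [set y0 - d | d in D] k) y <->
  [set t : R | D (y0 - y + t *: k)] !=set0.
Proof.
rewrite /domnu /= phi_reflectE; set T := [set t | _]; split.
  by rewrite /infnu; case: (eqVneq T set0) => [_ [[r]|]|/set0P].
move=> [t Tt]; move: (infnu_le Tt).
by case: (infnu T) => [[r| |]|] //= _; [left; exists r|right].
Qed.

(** From an interior point one may move a little in the direction [- k] without
    leaving [D]; conversely, moving from a point of [D] by a positive multiple
    of [k] leads into the interior. *)
Lemma core_lineP D k z :
  [set d + t *: k | d in D & t in [set t : R | 0 < t]] `<=` core D ->
  core D z <-> exists2 t : R, t < 0 & D (z + t *: k).
Proof.
move=> hD; split=> [[_ /(_ (- k)) [e e0 De]]|[t t0 Dt]].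
  exists (- e); first by rewrite oppr_lt0.
  by rewrite scaleNr -scalerN; apply: De; rewrite lexx ltW.
apply: hD; exists (z + t *: k) => //; exists (- t); first by rewrite /= oppr_gt0.
by rewrite scaleNr addrK.
Qed.

Lemma WEffP F D y0 :
  WEff F D y0 <->
  F y0 /\ forall y, F y -> y <> y0 -> ~ core D (y0 - y).
Proof.
split=> -[Fy0 H]; split=> // y.
  move=> Fy yy0 cy; apply: yy0; apply: H; split=> //.
  by exists (y0 - y) => //; rewrite subKr.
move=> [Fy [d cd dy]]; apply: contrapT => yy0; apply: (H y Fy yy0).
by rewrite -dy subKr.
Qed.

Lemma WEff_phi_ge0 F D k :
  [set d + t *: k | d in D & t in [set t : R | 0 < t]] `<=` core D ->
  WEff F D =
    [set y0 | F y0 /\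
      forall y, ((F `&` domnu (phi [set y0 - d | d in D] k)) `\ y0) y ->
        lenu (Some 0%E) (phi [set y0 - d | d in D] k y)].
Proof.
move=> hD; apply/seteqP; split=> y0.
  move=> /WEffP [Fy0 H]; split=> // y [[Fy /domnu_phiP dy] yy0].
  rewrite phi_reflectE; apply/(infnu_ge0 dy) => t Dt.
  rewrite leNgt; apply/negP => t0; apply: (H y Fy yy0).
  by apply/(core_lineP _ hD); exists t.
move=> [Fy0 H]; apply/WEffP; split=> // y Fy yy0 /(core_lineP _ hD) [t t0 Dt].
have dy : [set t : R | D (y0 - y + t *: k)] !=set0 by exists t.
have : lenu (Some 0%E) (phi [set y0 - d | d in D] k y).
  by apply: H; split=> //; split=> //; apply/domnu_phiP.
by rewrite phi_reflectE => /(infnu_ge0 dy) /(_ t Dt); rewrite leNgt t0.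
Qed.

Lemma phi_self_le0 D k y0 : D 0 ->
  lenu (phi [set y0 - d | d in D] k y0) (Some 0%E).
Proof.
by move=> D0; rewrite phi_reflectE; apply: infnu_le; rewrite /= subrr scale0r addr0.
Qed.

Lemma phi_self_eq0 D k y0 :
  [set d + t *: k | d in D & t in [set t : R | 0 < t]] `<=` core D ->
  (D `\` core D) 0 ->
  phi [set y0 - d | d in D] k y0 = Some 0%E.
Proof.
move=> hD [D0 nc0]; apply: lenu_anti; first exact: phi_self_le0.
rewrite phi_reflectE; apply/infnu_ge0.
  by exists 0; rewrite /= subrr scale0r addr0.
move=> t /=; rewrite subrr => Dt; rewrite leNgt; apply/negP => t0.
by apply: nc0; apply/(core_lineP _ hD); exists t.
Qed.

Lemma WEff_phi_min F D k :
  [set d + t *: k | d in D & t in [set t : R | 0 < t]] `<=` core D ->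
  (D `\` core D) 0 ->
  WEff F D =
    [set y0 | F y0 /\
      is_min (phi [set y0 - d | d in D] k)
        (F `&` domnu (phi [set y0 - d | d in D] k))
        (phi [set y0 - d | d in D] k y0)].
Proof.
move=> hD D0; rewrite (WEff_phi_ge0 F hD).
apply/seteqP; split=> y0 [Fy0 H]; split=> //.
  have phi0 := phi_self_eq0 y0 hD D0.
  split; first by exists y0 => //; split=> //; left; exists 0.
  move=> y Sy; rewrite phi0.
  have [->|yy0] := pselect (y = y0); first by rewrite phi0 /=.
  exact: H.
by move=> y [Sy _]; rewrite -(phi_self_eq0 y0 hD D0); apply: H.2.
Qed.

End WeakEfficiency.

Theorem theorem8 (R : realType) (Y : lmodType R) (F D : set Y) (k : Y)
    (D_nonempty : D !=set0) (D_proper : D `<` setT) (k_neq0 : k != 0)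
    (hD : [set d + t *: k | d in D & t in [set t : R | 0 < t]] `<=` core D) :
  (WEff F D =
     [set y0 | F y0 /\
       forall y, ((F `&` domnu (phi [set y0 - d | d in D] k)) `\ y0) y ->
         lenu (Some 0%E) (phi [set y0 - d | d in D] k y)] /\
   WEff F D =
     [set y0 | F y0 /\
       forall y, ((F `&` domnu (phi [set y0 - d | d in D] k)) `\ y0) y ->
         lenu (Some 0%E) (phi [set - d | d in D] k (y - y0))]) /\
  (opp_dir_closed k D ->
    (D 0 -> forall y0 : Y,
       phi [set y0 - d | d in D] k y0 = phi [set - d | d in D] k (y0 - y0) /\
       lenu (phi [set - d | d in D] k (y0 - y0)) (Some 0%E)) /\
    ((D `\` core D) 0 ->
       (forall y0 : Y,
          phi [set y0 - d | d in D] k y0 = phi [set - d | d in D] k (y0 - y0) /\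
          phi [set - d | d in D] k (y0 - y0) = Some 0%E) /\
       WEff F D =
         [set y0 | F y0 /\
           is_min (phi [set y0 - d | d in D] k)
             (F `&` domnu (phi [set y0 - d | d in D] k))
             (phi [set y0 - d | d in D] k y0)] /\
       WEff F D =
         [set y0 | F y0 /\
           is_min (fun y => phi [set - d | d in D] k (y - y0))
             (F `&` domnu (phi [set y0 - d | d in D] k))
             (phi [set - d | d in D] k (y0 - y0))])).
Proof.
(* As an equality of functions, so that it applies under [is_min]. *)
have transE y0 : (fun y => phi [set - d | d in D] k (y - y0)) =
    phi [set y0 - d | d in D] k by apply/funext => y; exact: phi_translate.
split; first split; first exact: WEff_phi_ge0.
  rewrite (WEff_phi_ge0 F hD); apply/seteqP.
  by split=> y0 [Fy0 H]; split=> // y /H; rewrite phi_translate.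
move=> _; split=> [D0 y0|D0].
  by rewrite phi_translate; split=> //; exact: phi_self_le0.
split=> [y0|]; first by rewrite phi_translate phi_self_eq0.
split; first exact: WEff_phi_min.
rewrite (WEff_phi_min F hD D0); apply/seteqP.
by split=> y0; rewrite /= transE phi_translate.
Qed.
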